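(* Let $n\ge 2$ and let $F_{n,2n+1}=F_n*\mathbb{Z}^{2n+1}$, where $F_n$ is the free group on $x_1,\dots,x_n$ and $\mathbb{Z}^{2n+1}$ is the free abelian group freely generated by $u_1,\dots,u_n,v_0,v_1,\dots,v_n$. The mapping $\varphi_M$ defined on the generators of the virtual braid group $VB_n$ by (generators not listed are fixed) $$\varphi_M(\sigma_i):\; x_i\mapsto x_i\,x_{i+1}^{u_i}\,x_i^{-v_0u_{i+1}},\quad x_{i+1}\mapsto x_i^{v_0},\quad u_i\mapsto u_{i+1},\quad u_{i+1}\mapsto u_i,\quad v_i\mapsto v_{i+1},\quad v_{i+1}\mapsto v_i,$$ $$\varphi_M(\rho_i):\; x_i\mapsto x_{i+1}^{v_i^{-1}},\quad x_{i+1}\mapsto x_i^{v_{i+1}},\quad u_i\mapsto u_{i+1},\quad u_{i+1}\mapsto u_i,\quad v_i\mapsto v_{i+1},\quad v_{i+1}\mapsto v_i,$$ for $1\le i\le n-1$, gives a representation (homomorphism) $\varphi_M: VB_n\to \mathrm{Aut}(F_{n,2n+1})$.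
   Context: Notation: $a^b=b^{-1}ab$ and $a^{-b}=(a^{-1})^b=b^{-1}a^{-1}b$. The virtual braid group $VB_n$ is generated by $\sigma_1,\dots,\sigma_{n-1},\rho_1,\dots,\rho_{n-1}$ with defining relations: $\sigma_i\sigma_{i+1}\sigma_i=\sigma_{i+1}\sigma_i\sigma_{i+1}$ and $\rho_i\rho_{i+1}\rho_i=\rho_{i+1}\rho_i\rho_{i+1}$ and $\rho_i\rho_{i+1}\sigma_i=\sigma_{i+1}\rho_i\rho_{i+1}$ for $1\le i\le n-2$; $\sigma_i\sigma_j=\sigma_j\sigma_i$, $\rho_i\rho_j=\rho_j\rho_i$, $\sigma_i\rho_j=\rho_j\sigma_i$ for $|i-j|\ge 2$; $\rho_i^2=1$ for $1\le i\le n-1$. Automorphisms act on the right: the product $\varphi\psi$ of two automorphisms means first apply $\varphi$, then $\psi$. *)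

(* Defs.v *)
(* The groups below are infinite, so quotients and the choice structure of the
   automorphism groups rely on the classical axioms of boolp. *)
From HB Require Import structures.
From mathcomp Require Import all_boot all_algebra.
From mathcomp Require Import boolp.

Set Implicit Arguments.
Unset Strict Implicit.
Unset Printing Implicit Defensive.

Local Open Scope group_scope.
Local Open Scope quotient_scope.

(* In a word, the letter (x, false) stands for x and (x, true) for x^-1. *)
Section FreeGroup.
Variable X : choiceType.

Notation word := (seq (X * bool)).

Definition inv_letter (l : X * bool) := (l.1, ~~ l.2).

Inductive free_eq : word -> word -> Prop :=
| free_refl w : free_eq w w
| free_sym w1 w2 : free_eq w1 w2 -> free_eq w2 w1
| free_trans w1 w2 w3 : free_eq w1 w2 -> free_eq w2 w3 -> free_eq w1 w3
| free_cancel w1 l w2 : free_eq (w1 ++ [:: l, inv_letter l & w2]) (w1 ++ w2).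

Definition free_rel (w1 w2 : word) : bool := `[< free_eq w1 w2 >].

Fact free_rel_equiv : equiv_class_of free_rel.
Proof.
split.
- by move=> w; apply/asboolP; apply: free_refl.
- by move=> w1 w2; apply/asboolP/asboolP; apply: free_sym.
- move=> w1 w2 w3 /asboolP h12 /asboolP h23; apply/asboolP.
  exact: free_trans h12 h23.
Qed.
Canonical free_equiv := EquivRelPack free_rel_equiv.

Definition free_group := {eq_quot free_equiv}.
HB.instance Definition _ := Choice.on free_group.
HB.instance Definition _ := EqQuotient.on free_group.

Definition free_gen (x : X) : free_group := \pi_free_group [:: (x, false)].

Definition inv_word (w : word) : word := rev (map inv_letter w).

Definition free_one : free_group := \pi_free_group [::].
Definition free_mul (a b : free_group) : free_group :=
  \pi_free_group (repr a ++ repr b).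
Definition free_inv (a : free_group) : free_group :=
  \pi_free_group (inv_word (repr a)).

Lemma free_piP w1 w2 :
  \pi_free_group w1 = \pi_free_group w2 <-> free_eq w1 w2.
Proof.
split=> [/eqP|h]; last by apply/eqmodP/asboolP.
by rewrite piE => /asboolP.
Qed.

Lemma free_reprP w : free_eq (repr (\pi_free_group w)) w.
Proof. by apply/free_piP; rewrite reprK. Qed.

Lemma inv_letterK : involutive inv_letter.
Proof. by case=> x b; rewrite /inv_letter /= negbK. Qed.

Lemma free_catl w w1 w2 : free_eq w1 w2 -> free_eq (w ++ w1) (w ++ w2).
Proof.
elim=> [w'|w3 w4 _|w3 w4 w5 _ h1 _|w3 l w4].
- exact: free_refl.
- exact: free_sym.
- exact: free_trans h1.
- by rewrite !catA; apply: free_cancel.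
Qed.

Lemma free_catr w w1 w2 : free_eq w1 w2 -> free_eq (w1 ++ w) (w2 ++ w).
Proof.
elim=> [w'|w3 w4 _|w3 w4 w5 _ h1 _|w3 l w4].
- exact: free_refl.
- exact: free_sym.
- exact: free_trans h1.
- by rewrite -!catA; apply: free_cancel.
Qed.

Lemma free_cat w1 w2 w3 w4 :
  free_eq w1 w2 -> free_eq w3 w4 -> free_eq (w1 ++ w3) (w2 ++ w4).
Proof.
by move=> h12 h34; apply: free_trans (free_catr _ h12) (free_catl _ h34).
Qed.

Lemma free_invr w : free_eq (w ++ inv_word w) [::].
Proof.
elim: w => [|l w ih]; first exact: free_refl.
have -> : (l :: w) ++ inv_word (l :: w)
    = [:: l] ++ (w ++ inv_word w) ++ [:: inv_letter l].
  by rewrite /inv_word /= rev_cons -cats1 -catA.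
apply: free_trans (free_catl _ (free_catr _ ih)) _.
exact: (@free_cancel [::] l [::]).
Qed.

Lemma inv_wordK : involutive inv_word.
Proof.
by move=> w; rewrite /inv_word map_rev revK (mapK inv_letterK).
Qed.

Lemma free_invl w : free_eq (inv_word w ++ w) [::].
Proof. by rewrite -{2}[w]inv_wordK; apply: free_invr. Qed.

Lemma free_mulA : associative free_mul.
Proof.
move=> a b c; apply/free_piP.
apply: free_trans (free_catl _ (free_reprP _)) _; rewrite catA.
exact: free_catr (free_sym (free_reprP _)).
Qed.

Lemma free_mul1g : left_id free_one free_mul.
Proof.
move=> a; rewrite -[RHS]reprK; apply/free_piP.
exact: free_catr (free_reprP [::]).
Qed.

Lemma free_mulg1 : right_id free_one free_mul.
Proof.
move=> a; rewrite -[RHS]reprK; apply/free_piP.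
by rewrite -[X in free_eq _ X]cats0; apply: free_catl (free_reprP [::]).
Qed.

Lemma free_mulVg : left_inverse free_one free_inv free_mul.
Proof.
move=> a; apply/free_piP; apply: free_trans (free_invl (repr a)).
exact: free_catr (free_reprP _).
Qed.

Lemma free_mulgV : right_inverse free_one free_inv free_mul.
Proof.
move=> a; apply/free_piP; apply: free_trans (free_invr (repr a)).
exact: free_catl (free_reprP _).
Qed.

HB.instance Definition _ := isGroup.Build free_group
  free_mulA free_mul1g free_mulg1 free_mulVg free_mulgV.

End FreeGroup.

(* The quotient of G by the smallest congruence containing R, that is, by the
   normal closure of the elements a * b^-1 with R a b. *)
Section QuotientByRelations.
Variables (G : groupType) (R : G -> G -> Prop).

Inductive cong : G -> G -> Prop :=
| cong_rel a b : R a b -> cong a b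
| cong_refl a : cong a a
| cong_sym a b : cong a b -> cong b a
| cong_trans a b c : cong a b -> cong b c -> cong a c
| cong_mul a b c d : cong a b -> cong c d -> cong (a * c) (b * d).

Definition congb (a b : G) : bool := `[< cong a b >].

Fact congb_equiv : equiv_class_of congb.
Proof.
split.
- by move=> a; apply/asboolP; apply: cong_refl.
- by move=> a b; apply/asboolP/asboolP; apply: cong_sym.
- by move=> a b c /asboolP hab /asboolP hbc; apply/asboolP; apply: cong_trans hbc.
Qed.
Canonical cong_equiv := EquivRelPack congb_equiv.

Definition rel_quot := {eq_quot cong_equiv}.
HB.instance Definition _ := Choice.on rel_quot.
HB.instance Definition _ := EqQuotient.on rel_quot.

Definition rel_class (a : G) : rel_quot := \pi_rel_quot a.

Definition rel_quot_one : rel_quot := rel_class 1.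
Definition rel_quot_mul (a b : rel_quot) : rel_quot :=
  rel_class (repr a * repr b).
Definition rel_quot_inv (a : rel_quot) : rel_quot := rel_class (repr a)^-1.

Lemma rel_classP a b : rel_class a = rel_class b <-> cong a b.
Proof.
split=> [/eqP|h]; last by apply/eqmodP/asboolP.
by rewrite /rel_class piE => /asboolP.
Qed.

Lemma rel_reprP a : cong (repr (rel_class a)) a.
Proof. by apply/rel_classP; rewrite /rel_class reprK. Qed.

Lemma rel_quot_mulA : associative rel_quot_mul.
Proof.
move=> a b c; apply/rel_classP.
apply: cong_trans (cong_mul (cong_refl _) (rel_reprP _)) _; rewrite mulgA.
exact: cong_mul (cong_sym (rel_reprP _)) (cong_refl _).
Qed.

Lemma rel_quot_mul1g : left_id rel_quot_one rel_quot_mul.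
Proof.
move=> a; rewrite -[RHS]reprK; apply/rel_classP.
by rewrite -[X in cong _ X]mul1g; apply: cong_mul (rel_reprP _) (cong_refl _).
Qed.

Lemma rel_quot_mulg1 : right_id rel_quot_one rel_quot_mul.
Proof.
move=> a; rewrite -[RHS]reprK; apply/rel_classP.
by rewrite -[X in cong _ X]mulg1; apply: cong_mul (cong_refl _) (rel_reprP _).
Qed.

Lemma rel_quot_mulVg : left_inverse rel_quot_one rel_quot_inv rel_quot_mul.
Proof.
move=> a; apply/rel_classP; rewrite -[X in cong _ X](mulVg (repr a)).
exact: cong_mul (rel_reprP _) (cong_refl _).
Qed.

Lemma rel_quot_mulgV : right_inverse rel_quot_one rel_quot_inv rel_quot_mul.
Proof.
move=> a; apply/rel_classP; rewrite -[X in cong _ X](mulgV (repr a)).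
exact: cong_mul (cong_refl _) (rel_reprP _).
Qed.

HB.instance Definition _ := isGroup.Build rel_quot rel_quot_mulA
  rel_quot_mul1g rel_quot_mulg1 rel_quot_mulVg rel_quot_mulgV.

End QuotientByRelations.

Section FreeProduct.
Variables G H : groupType.

Notation letter := (@free_gen (G + H)%type).

(* The multiplication tables of the two factors. *)
Inductive free_prod_rel :
  free_group (G + H)%type -> free_group (G + H)%type -> Prop :=
| free_prod_rell (a b : G) :
    free_prod_rel (letter (inl a) * letter (inl b)) (letter (inl (a * b)))
| free_prod_relr (a b : H) :
    free_prod_rel (letter (inr a) * letter (inr b)) (letter (inr (a * b))).

Definition free_prod : groupType := rel_quot free_prod_rel.

Definition free_prod_inl (a : G) : free_prod :=
  rel_class free_prod_rel (letter (inl a)).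
Definition free_prod_inr (b : H) : free_prod :=
  rel_class free_prod_rel (letter (inr b)).

End FreeProduct.

(* The additive group of integers, written multiplicatively; {ffun I -> intM}
   is then Z^I as a multiplicative group, with pointwise operations. *)
Section IntM.
Import GRing.Theory.

Definition intM : Type := int.
HB.instance Definition _ := Choice.on intM.
HB.instance Definition _ := isGroup.Build intM
  (@addrA int) (@add0r int) (@addr0 int) (@addNr int) (@addrN int).

End IntM.

Definition free_abelian (I : finType) : groupType := {ffun I -> intM}.

Definition free_abelian_gen (I : finType) (i : I) : free_abelian I :=
  [ffun k => (if k == i then 1%Z else 0%Z) : intM].

Section Automorphisms.
Variable G : groupType.

Record group_aut := GroupAut {
  aut_fun :> G -> G;
  autM : {morph aut_fun : a b / a * b};
  aut_bij : bijective aut_fun }.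

HB.instance Definition _ := gen_eqMixin group_aut.
HB.instance Definition _ := gen_choiceMixin group_aut.

Lemma autP (f g : group_aut) : f =1 g -> f = g.
Proof.
case: f g => [f fM fb] [g gM gb] /= /funext fg; subst g.
by congr GroupAut; apply: Prop_irrelevance.
Qed.

Definition aut_one : group_aut :=
  GroupAut (fun a b => erefl) (@inv_bij _ id (frefl _)).

Lemma aut_mul_morph (f g : group_aut) : {morph g \o f : a b / a * b}.
Proof. by move=> a b /=; rewrite !autM. Qed.

(* Automorphisms act on the right: f * g is f followed by g. *)
Definition aut_mul (f g : group_aut) : group_aut :=
  GroupAut (aut_mul_morph f g) (bij_comp (aut_bij g) (aut_bij f)).

Lemma aut_inv_ex (f : group_aut) :
  exists g : group_aut, cancel f g /\ cancel g f.
Proof.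
have [g fK gK] := aut_bij f.
have gM : {morph g : a b / a * b}.
  by move=> a b; apply: (can_inj fK); rewrite autM !gK.
by exists (GroupAut gM (Bijective gK fK)).
Qed.

Definition aut_inv (f : group_aut) : group_aut := sval (cid (aut_inv_ex f)).

Lemma aut_mulA : associative aut_mul.
Proof. by move=> f g h; apply: autP. Qed.
Lemma aut_mul1g : left_id aut_one aut_mul.
Proof. by move=> f; apply: autP. Qed.
Lemma aut_mulg1 : right_id aut_one aut_mul.
Proof. by move=> f; apply: autP. Qed.
Lemma aut_mulVg : left_inverse aut_one aut_inv aut_mul.
Proof.
by move=> f; apply: autP; rewrite /aut_inv; case: cid => g [/= fK gK]; apply: gK.
Qed.
Lemma aut_mulgV : right_inverse aut_one aut_inv aut_mul.
Proof.
by move=> f; apply: autP; rewrite /aut_inv; case: cid => g [/= fK gK]; apply: fK.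
Qed.

HB.instance Definition _ := isGroup.Build group_aut
  aut_mulA aut_mul1g aut_mulg1 aut_mulVg aut_mulgV.

End Automorphisms.

(* All indices are shifted by one with respect to the usual 1 <= i <= n:
   sigma_1, ..., sigma_(n-1) are indexed by 'I_n.-1 = {0, ..., n-2}, and
   x_1, ..., x_n by 'I_n = {0, ..., n-1}. *)
Section VirtualBraidGroup.
Variable n : nat.

Notation gens := ('I_n.-1 + 'I_n.-1)%type.
Notation s i := (@free_gen gens (inl i)).
Notation r i := (@free_gen gens (inr i)).

Definition far (i j : 'I_n.-1) : bool := (2 <= `|i%:Z - j%:Z|)%R.

Inductive vb_rel : free_group gens -> free_group gens -> Prop :=
| vb_sss (i j : 'I_n.-1) : j = i.+1 :> nat ->
    vb_rel (s i * s j * s i) (s j * s i * s j)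
| vb_rrr (i j : 'I_n.-1) : j = i.+1 :> nat ->
    vb_rel (r i * r j * r i) (r j * r i * r j)
| vb_rrs (i j : 'I_n.-1) : j = i.+1 :> nat ->
    vb_rel (r i * r j * s i) (s j * r i * r j)
| vb_ss (i j : 'I_n.-1) : far i j -> vb_rel (s i * s j) (s j * s i)
| vb_rr (i j : 'I_n.-1) : far i j -> vb_rel (r i * r j) (r j * r i)
| vb_sr (i j : 'I_n.-1) : far i j -> vb_rel (s i * r j) (r j * s i)
| vb_r2 (i : 'I_n.-1) : vb_rel (r i ^+ 2) 1.

Definition VB : groupType := rel_quot vb_rel.

Definition sigma (i : 'I_n.-1) : VB := rel_class vb_rel (s i).
Definition rho (i : 'I_n.-1) : VB := rel_class vb_rel (r i).

Fact strand_proof (i : 'I_n.-1) : i < n.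
Proof. exact: leq_trans (ltn_ord i) (leq_pred n). Qed.
Fact next_strand_proof (i : 'I_n.-1) : i.+1 < n.
Proof. by rewrite -ltn_predRL ltn_ord. Qed.

Definition strand (i : 'I_n.-1) : 'I_n := Ordinal (strand_proof i).
Definition next_strand (i : 'I_n.-1) : 'I_n := Ordinal (next_strand_proof i).

End VirtualBraidGroup.

(* F_n * Z^(2n+1): the summand 'I_n of the index type of the free abelian
   factor indexes u_1, ..., u_n and the summand 'I_n.+1 indexes
   v_0, v_1, ..., v_n (v_0 at ord0). *)
Section TargetGroup.
Variable n : nat.

Notation Fn := (free_group 'I_n).
Notation Zn := (free_abelian ('I_n + 'I_n.+1)%type).

Definition FZ : groupType := free_prod Fn Zn.

Definition x_ (j : 'I_n) : FZ := @free_prod_inl Fn Zn (free_gen j).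
Definition u_ (j : 'I_n) : FZ :=
  @free_prod_inr Fn Zn (free_abelian_gen (inl j)).
Definition v0 : FZ := @free_prod_inr Fn Zn (free_abelian_gen (inr ord0)).
Definition v_ (j : 'I_n) : FZ :=
  @free_prod_inr Fn Zn (free_abelian_gen (inr (lift ord0 j))).

End TargetGroup.
Arguments v0 {n}.

(* Main.v *)
(* A homomorphism out of F_n * Z^(2n+1) is determined by arbitrary images of the
   x_j and a homomorphism on Z^(2n+1). Both phi_M(sigma_i) and phi_M(rho_i)
   permute the u_j and the v_j by the transposition (i i+1), so on the torus the
   relations of VB_n are those of the symmetric group, and only the images of
   the x_j have to be compared. They agree because conjugations by elements of
   the torus commute with each other. The inverse of phi_M(sigma_i) sends x_i to
   x_(i+1)^(v_0^-1) and x_(i+1) to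
   (x_(i+1)^(-v_0^-1) x_i x_(i+1)^(u_i))^(u_(i+1)^-1). *)
Require Import Defs.
From HB Require Import structures.
From mathcomp Require Import all_boot all_algebra perm.
From mathcomp Require Import zify.
From mathcomp Require Import boolp.

Set Implicit Arguments.
Unset Strict Implicit.
Unset Printing Implicit Defensive.

Local Open Scope group_scope.
Local Open Scope quotient_scope.

(* mathcomp states these for maps already known to preserve 1, which
   multiplicative maps between groups are not declared to be. *)
Section MultiplicativeMaps.
Variables (G H : groupType) (f : {multiplicative G -> H}).

Lemma mult1 : f 1 = 1.
Proof. by apply: (mulgI (f 1)); rewrite -gmulfM !mulg1. Qed.

Lemma multV : {morph f : a / a^-1}.
Proof. by move=> a; apply: (mulgI (f a)); rewrite -gmulfM !mulgV mult1. Qed.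

Lemma multJ : {morph f : a b / a ^ b}.
Proof. by move=> a b; rewrite !gmulfM multV. Qed.

End MultiplicativeMaps.

(** * Universal property of the free group *)

Section FreeGroupUniversal.
Variables (X : choiceType) (K : groupType).

Section Lift.
Variable f : X -> K.

Definition letter_eval (l : X * bool) : K := if l.2 then (f l.1)^-1 else f l.1.

Lemma letter_evalV l : letter_eval (inv_letter l) = (letter_eval l)^-1.
Proof. by case: l => x [] /=; rewrite /letter_eval /= ?invgK. Qed.

(** A cancelling pair evaluates to an element times its inverse. This makes [free_lift], computed on
    a chosen representative, independent of the choice. *)
Lemma free_eq_eval w1 w2 : free_eq w1 w2 ->
  \prod_(l <- w1) letter_eval l = \prod_(l <- w2) letter_eval l.
Proof.
elim=> [//|_ _ _ -> //|_ _ _ _ -> _ -> //|w l w'].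
by rewrite !big_cat !big_cons letter_evalV /= mulVKg.
Qed.

Definition free_lift (a : free_group X) : K :=
  \prod_(l <- repr a) letter_eval l.

Lemma free_liftM : {morph free_lift : a b / a * b}.
Proof.
by move=> a b; rewrite /free_lift (free_eq_eval (free_reprP _)) big_cat.
Qed.
HB.instance Definition _ :=
  isMultiplicative.Build (free_group X) K free_lift free_liftM.

Lemma free_lift_gen x : free_lift (free_gen x) = f x.
Proof. by rewrite /free_lift (free_eq_eval (free_reprP _)) big_seq1. Qed.

End Lift.

Lemma free_group_ext (f g : {multiplicative free_group X -> K}) :
  (forall x, f (free_gen x) = g (free_gen x)) -> f =1 g.
Proof.
pose cl w : free_group X := \pi_(free_group X) w => fg a.
(* The product is defined on chosen representatives; in this form it allows an induction over the
   letters of a word. *)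
have clM w1 w2 : cl (w1 ++ w2) = cl w1 * cl w2.
  by apply/free_piP/free_sym/free_cat; apply: free_reprP.
rewrite -[a]reprK -/(cl _); elim: (repr a) => [|[x b] w ih].
  by have -> : cl [::] = 1 by []; rewrite !mult1.
rewrite -cat1s clM !gmulfM ih; congr (_ * _).
case: b; last exact: fg.
have -> : cl [:: (x, true)] = (free_gen x)^-1.
  apply: (mulgI (free_gen x)); rewrite mulgV -clM.
  exact/free_piP/(free_cancel [::] (x, false) [::]).
by rewrite !multV fg.
Qed.

End FreeGroupUniversal.

(** * Universal property of the quotient by relations *)

Section RelQuotUniversal.
Variables (G K : groupType) (R : G -> G -> Prop).

Lemma rel_classM (a b : G) : rel_class R (a * b) = rel_class R a * rel_class R b.
Proof. by apply/rel_classP; apply/cong_sym/cong_mul; apply: rel_reprP. Qed.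

(** By induction on its derivation, the whole congruence is respected by [f], so [f] may be
    evaluated at representatives. *)
Lemma rel_quot_lift (f : {multiplicative G -> K}) :
  (forall a b, R a b -> f a = f b) ->
  exists h : {multiplicative rel_quot R -> K}, forall a, h (rel_class R a) = f a.
Proof.
move=> fR.
have fcong a b : cong R a b -> f a = f b.
  elim=> {a b} [||_ _ _ ->|_ _ _ _ -> _ ->|a b c d _ ab _ cd] //.
  by rewrite !gmulfM ab cd.
pose h (q : rel_quot R) := f (repr q).
have hM : {morph h : p q / p * q}.
  by move=> p q; rewrite /h (fcong _ _ (rel_reprP _ _)) gmulfM.
pose hm := isMultiplicative.Build _ _ h hM.
exists (HB.pack_for {multiplicative rel_quot R -> K} h hm) => a.
exact: fcong (rel_reprP _ _).
Qed.

Lemma rel_quot_ext (T : Type) (f g : rel_quot R -> T) :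
  (forall a, f (rel_class R a) = g (rel_class R a)) -> f =1 g.
Proof. by move=> fg q; rewrite -[q]reprK; apply: fg. Qed.

End RelQuotUniversal.

HB.instance Definition _ (G : groupType) (R : G -> G -> Prop) :=
  isMultiplicative.Build G (rel_quot R) (rel_class R) (@rel_classM G R).

(** * Universal property of the free product *)

Section FreeProductUniversal.
Variables G H : groupType.

Lemma free_prod_inlM : {morph @free_prod_inl G H : a b / a * b}.
Proof.
move=> a b; rewrite /free_prod_inl -rel_classM.
by apply/esym/rel_classP/cong_rel/free_prod_rell.
Qed.
HB.instance Definition _ :=
  isMultiplicative.Build G (free_prod G H) (@free_prod_inl G H) free_prod_inlM.

Lemma free_prod_inrM : {morph @free_prod_inr G H : a b / a * b}.
Proof.
move=> a b; rewrite /free_prod_inr -rel_classM.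
by apply/esym/rel_classP/cong_rel/free_prod_relr.
Qed.
HB.instance Definition _ :=
  isMultiplicative.Build H (free_prod G H) (@free_prod_inr G H) free_prod_inrM.

Variable K : groupType.

(** Every element of either factor is a letter of the presentation, so [fg] prescribes the images of
    all letters; the multiplication tables hold because [f] and [g] are multiplicative. *)
Lemma free_prod_lift (f : {multiplicative G -> K}) (g : {multiplicative H -> K}) :
  exists h : {multiplicative free_prod G H -> K},
    (forall a, h (free_prod_inl H a) = f a) /\
    (forall b, h (free_prod_inr G b) = g b).
Proof.
pose fg (c : G + H) := match c with inl a => f a | inr b => g b end.
case: (@rel_quot_lift _ K (@free_prod_rel G H) (free_lift fg)) => [_ _ [] a b|h hE].
- by rewrite gmulfM /= !free_lift_gen /= gmulfM.
- by rewrite gmulfM /= !free_lift_gen /= gmulfM.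
- by exists h; split=> a; rewrite hE /= free_lift_gen.
Qed.

Lemma free_prod_ext (f g : {multiplicative free_prod G H -> K}) :
  (forall a, f (free_prod_inl H a) = g (free_prod_inl H a)) ->
  (forall b, f (free_prod_inr G b) = g (free_prod_inr G b)) -> f =1 g.
Proof.
move=> fgl fgr; apply: rel_quot_ext => w.
apply: (@free_group_ext _ _ (f \o rel_class _) (g \o rel_class _)).
by case=> [a|b]; [apply: fgl | apply: fgr].
Qed.

End FreeProductUniversal.

(** * Identities between products of conjugates *)

Section ConjugationWords.
Variable G : groupType.

(* Unification would otherwise see through x ^ y to the product y^-1 * (x * y). *)
Definition cj (c t : G) : G := locked (c ^ t).

Lemma cjE c t : cj c t = c ^ t. Proof. by rewrite /cj -lock. Qed.
Lemma cjM c d t : cj (c * d) t = cj c t * cj d t.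
Proof. by rewrite !cjE conjMg. Qed.
Lemma cjV c t : cj c^-1 t = (cj c t)^-1.
Proof. by rewrite !cjE conjVg. Qed.
Lemma cjJ c t t' : cj c (t * t') = cj (cj c t) t'.
Proof. by rewrite !cjE conjgM. Qed.
Lemma cjK c t : cj (cj c t) t^-1 = c.
Proof. by rewrite !cjE -conjgM mulgV conjg1. Qed.
Lemma cjVK c t : cj (cj c t^-1) t = c.
Proof. by rewrite !cjE -conjgM mulVg conjg1. Qed.
Lemma cjAC t t' : commute t t' -> forall c, cj (cj c t) t' = cj (cj c t') t.
Proof. by move=> tt' c; rewrite !cjE -!conjgM tt'. Qed.

(** The image of $x_i$ under $\varphi_M(\sigma_i)$, with [x], [y] for $x_i$, $x_{i+1}$, [s] for
    $v_0$, and [u], [v] for $u_i$, $u_{i+1}$. *)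
Definition sigma_word (x y s u v : G) : G := x * y ^ u * x^-1 ^ (s * v).

(** The value at $x_i$ of $\varphi_M(\sigma_i)$ followed by its inverse: conjugating [y ^ s^-1] by
    [s * u] gives [y ^ u], which cancels the end of the middle factor. *)
Lemma sigma_word_inv_l (x y s u v : G) :
  y ^ s^-1 * (((y ^ s^-1)^-1 * x * y ^ u) ^ v^-1) ^ v * (y ^ s^-1)^-1 ^ (s * u) = x.
Proof. by rewrite -!cjE !(cjV, cjM, cjJ) !cjVK !mulgA mulgV mul1g mulgK. Qed.

(** The composite in the other order, at $x_{i+1}$. *)
Lemma sigma_word_inv_r (x y s u v : G) :
  (((x ^ s) ^ s^-1)^-1 * sigma_word x y s u v * (x ^ s) ^ v) ^ u^-1 = y.
Proof.
by rewrite /sigma_word -!cjE !(cjV, cjM, cjJ) !cjK !mulgA mulVg mul1g mulgVK.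
Qed.

(** The braid relation for the $\sigma_i$ at the first of three strands. On the left the conjugates
    of [x] by [s * v] and by [s * s * v * w] each meet their inverse and cancel. *)
Lemma sigma_word_braid (x y z s u v w : G) :
  commute s u -> commute s v -> commute s w ->
  commute u v -> commute u w -> commute v w ->
  sigma_word x y s u v * sigma_word (x ^ s) z s u w ^ v
    * (sigma_word x y s u v)^-1 ^ (s * w)
  = x * sigma_word y z s v w ^ u * x^-1 ^ (s * w).
Proof.
move=> su sv sw uv uw vw; rewrite /sigma_word -!cjE !(cjV, cjM, cjJ).
(* Nested conjugations are sorted: [s] innermost, then [w], [v], [u]. *)
rewrite -?(cjAC su) -?(cjAC sv) -?(cjAC sw) ?(cjAC uv) ?(cjAC uw) ?(cjAC vw).
by rewrite !invgM !invgK !mulgA !mulgVK.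
Qed.

(** Settles the middle strand in [sigma_braid], where [w] is $v_0$, and in [mixed_braid], where [w]
    is the [v] of the third strand. *)
Lemma sigma_wordJ (x y s u v w : G) :
  commute s w -> commute u w -> commute v w ->
  sigma_word x y s u v ^ w = sigma_word (x ^ w) (y ^ w) s u v.
Proof.
move=> sw uw vw; rewrite /sigma_word -!cjE !(cjV, cjM, cjJ).
by rewrite -(cjAC sw) (cjAC uw) (cjAC vw).
Qed.

Lemma conjgAC (x t t' : G) : commute t t' -> (x ^ t) ^ t' = (x ^ t') ^ t.
Proof. by move=> tt'; rewrite -!cjE cjAC. Qed.

End ConjugationWords.

HB.instance Definition _ (G : groupType) (f : group_aut G) :=
  isMultiplicative.Build G G f (autM f).

(* Sealed: unification otherwise compares generators by unfolding the quotients. *)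
HB.lock Definition xgen n (j : 'I_n) : FZ n := x_ j.
HB.lock Definition tgen n (k : ('I_n + 'I_n.+1)%type) : FZ n :=
  @free_prod_inr (free_group 'I_n) _ (free_abelian_gen k).

Lemma x_E n j : @x_ n j = xgen j. Proof. by rewrite xgen.unlock. Qed.
Lemma u_E n j : @u_ n j = tgen (inl j). Proof. by rewrite tgen.unlock. Qed.
Lemma v0_E n : @v0 n = tgen (inr ord0). Proof. by rewrite tgen.unlock. Qed.
Lemma v_E n j : @v_ n j = tgen (inr (lift ord0 j)).
Proof. by rewrite tgen.unlock. Qed.

(** * Endomorphisms that permute the generators of the torus *)

Section Endomorphisms.
Variable n : nat.

Notation Zn := (free_abelian ('I_n + 'I_n.+1)%type).
Notation torus := (@free_prod_inr (free_group 'I_n) Zn).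

(** The [u] and the [v] indices move in parallel, and the index [ord0] of $v_0$ stays fixed. *)
Definition index_perm (p : 'S_n) (k : 'I_n + 'I_n.+1) : 'I_n + 'I_n.+1 :=
  match k with
  | inl j => inl (p j)
  | inr m => inr (if unlift ord0 m is Some j then lift ord0 (p j) else ord0)
  end.

Lemma index_perm_inl p j : index_perm p (inl j) = inl (p j). Proof. by []. Qed.
Lemma index_perm_ord0 p : index_perm p (inr ord0) = inr ord0.
Proof. by rewrite /= unlift_none. Qed.
Lemma index_perm_lift p j :
  index_perm p (inr (lift ord0 j)) = inr (lift ord0 (p j)).
Proof. by rewrite /= liftK. Qed.

Lemma index_permM p q k : index_perm (p * q) k = index_perm q (index_perm p k).
Proof.
case: k => [j|m] /=; rewrite ?permM //.
by case: (unliftP ord0 m) => [j _|_]; rewrite ?liftK ?unlift_none ?permM.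
Qed.

Lemma index_perm1 k : index_perm 1 k = k.
Proof.
case: k => [j|m] /=; rewrite ?perm1 //.
by case: (unliftP ord0 m) => [j|] ->; rewrite ?perm1.
Qed.

(** Coordinates are pulled back along [p^-1] so that generators are pushed forward along [p], as in
    [torus_perm_gen]. *)
Definition torus_perm (p : 'S_n) (z : Zn) : Zn :=
  [ffun k => z (index_perm p^-1 k)].

Lemma torus_permM p q z : torus_perm q (torus_perm p z) = torus_perm (p * q) z.
Proof. by apply/ffunP=> k; rewrite !ffunE invgM index_permM. Qed.

Lemma torus_perm1 z : torus_perm 1 z = z.
Proof. by apply/ffunP=> k; rewrite ffunE invg1 index_perm1. Qed.

Lemma torus_perm_gen p k :
  torus_perm p (free_abelian_gen k) = free_abelian_gen (index_perm p k).
Proof.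
apply/ffunP=> l; rewrite !ffunE; congr (if _ then _ else _).
by apply/eqP/eqP=> [<-|->]; rewrite -index_permM ?mulVg ?mulgV index_perm1.
Qed.

Lemma torus_perm_morph p : {morph torus_perm p : z w / z * w}.
Proof. by move=> z w; apply/ffunP=> k; rewrite !ffunE. Qed.
HB.instance Definition _ p :=
  isMultiplicative.Build Zn Zn (torus_perm p) (torus_perm_morph p).

Lemma FZ_end_ex (p : 'S_n) (y : 'I_n -> FZ n) :
  exists h : {multiplicative FZ n -> FZ n},
    (forall j, h (x_ j) = y j) /\
    (forall z, h (torus z) = torus (torus_perm p z)).
Proof.
have [h [hl hr]] := free_prod_lift (free_lift y) (torus \o torus_perm p).
by exists h; split=> [j|//]; rewrite hl /= free_lift_gen.
Qed.

(** A choice among the maps of [FZ_end_ex]; by [FZ_ext] there is only one. *)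
Definition FZ_end p y : {multiplicative FZ n -> FZ n} := sval (cid (FZ_end_ex p y)).

Lemma FZ_end_x p y j : FZ_end p y (xgen j) = y j.
Proof. by rewrite xgen.unlock /FZ_end; case: cid => h []. Qed.

Lemma FZ_end_torus p y z : FZ_end p y (torus z) = torus (torus_perm p z).
Proof. by rewrite /FZ_end; case: cid => h []. Qed.

Lemma FZ_end_t p y k : FZ_end p y (tgen k) = tgen (index_perm p k).
Proof. by rewrite tgen.unlock FZ_end_torus torus_perm_gen. Qed.

Lemma FZ_ext (f g : {multiplicative FZ n -> FZ n}) :
  (forall j, f (xgen j) = g (xgen j)) ->
  (forall z, f (torus z) = g (torus z)) -> f =1 g.
Proof.
rewrite xgen.unlock => fgx; apply: free_prod_ext.
exact: (@free_group_ext _ _ (f \o @free_prod_inl _ Zn) (g \o @free_prod_inl _ Zn)).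
Qed.

Lemma tgenC k l : commute (tgen k) (tgen l : FZ n).
Proof.
rewrite tgen.unlock /commute -!gmulfM; congr torus.
by apply/ffunP=> m; rewrite !ffunE; apply: GRing.addrC.
Qed.

(** * The endomorphisms attached to the two kinds of generators *)

Local Notation x := (@xgen n).
Local Notation u j := (@tgen n (inl j)).
Local Notation s := (@tgen n (inr ord0)).
Local Notation v j := (@tgen n (inr (lift ord0 j))).

(** The strands [a] and [b] are arbitrary here, so that the relations become statements about
    distinct strands, without index arithmetic. *)
Definition sigma_img (a b j : 'I_n) : FZ n :=
  if j == a then sigma_word (x a) (x b) s (u a) (u b)
  else if j == b then x a ^ s else x j.
Definition sigma_inv_img (a b j : 'I_n) : FZ n :=
  if j == a then x b ^ s^-1
  else if j == b then ((x b ^ s^-1)^-1 * x a * x b ^ u a) ^ (u b)^-1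
  else x j.
Definition rho_img (a b j : 'I_n) : FZ n :=
  if j == a then x b ^ (v a)^-1
  else if j == b then x a ^ v b else x j.

Lemma sigma_imgD a b j : j != a -> j != b -> sigma_img a b j = x j.
Proof. by rewrite /sigma_img => /negbTE-> /negbTE->. Qed.
Lemma rho_imgD a b j : j != a -> j != b -> rho_img a b j = x j.
Proof. by rewrite /rho_img => /negbTE-> /negbTE->. Qed.

Definition sigma_end a b := FZ_end (tperm a b) (sigma_img a b).
Definition sigma_inv_end a b := FZ_end (tperm a b) (sigma_inv_img a b).
Definition rho_end a b := FZ_end (tperm a b) (rho_img a b).

(* multJ comes first because gmulfM also matches conjugates, up to unfolding. *)
Definition FZ_endE p y :=
  (@multJ _ _ (FZ_end p y), @multV _ _ (FZ_end p y), @gmulfM _ _ (FZ_end p y),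
   FZ_end_x p y, FZ_end_t p y, index_perm_inl p, index_perm_ord0 p, index_perm_lift p).

Lemma sigma_endK a b : a != b -> cancel (sigma_end a b) (sigma_inv_end a b).
Proof.
move=> ab; have ba := negbTE ab; rewrite eq_sym in ba.
apply: (@FZ_ext (sigma_inv_end a b \o sigma_end a b) idfun) => [j|z] /=; last first.
  by rewrite !FZ_end_torus torus_permM tperm2 torus_perm1.
rewrite FZ_end_x /sigma_img.
case: eqP => [->|ja].
  rewrite !FZ_endE /sigma_inv_img !eqxx ba /= tpermL tpermR.
  exact: sigma_word_inv_l.
case: eqP => [->|jb].
  by rewrite !FZ_endE /sigma_inv_img eqxx -!cjE cjVK.
by rewrite !FZ_endE /sigma_inv_img; case: eqP => // _; case: eqP.
Qed.

Lemma sigma_inv_endK a b : a != b -> cancel (sigma_inv_end a b) (sigma_end a b).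
Proof.
move=> ab; have ba := negbTE ab; rewrite eq_sym in ba.
apply: (@FZ_ext (sigma_end a b \o sigma_inv_end a b) idfun) => [j|z] /=; last first.
  by rewrite !FZ_end_torus torus_permM tperm2 torus_perm1.
rewrite FZ_end_x /sigma_inv_img.
case: eqP => [->|ja].
  by rewrite !FZ_endE /sigma_img !eqxx ba -!cjE cjK.
case: eqP => [->|jb].
  rewrite !FZ_endE /sigma_img !eqxx ba /= !tpermL !tpermR.
  exact: sigma_word_inv_r.
by rewrite !FZ_endE /sigma_img; case: eqP => // _; case: eqP.
Qed.

(** The swap of [v a] and [v b] makes the two successive conjugating elements inverse to each
    other. *)
Lemma rho_endK a b : a != b -> cancel (rho_end a b) (rho_end a b).
Proof.
move=> ab; have ba := negbTE ab; rewrite eq_sym in ba.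
apply: (@FZ_ext (rho_end a b \o rho_end a b) idfun) => [j|z] /=; last first.
  by rewrite !FZ_end_torus torus_permM tperm2 torus_perm1.
rewrite FZ_end_x /rho_img.
case: eqP => [->|ja].
  by rewrite !FZ_endE /rho_img !eqxx ba !tpermL -!cjE cjK.
case: eqP => [->|jb].
  by rewrite !FZ_endE /rho_img !eqxx !tpermR -!cjE cjVK.
by rewrite !FZ_endE /rho_img; case: eqP => // _; case: eqP.
Qed.

(** * Relations on three consecutive strands *)

Section ThreeStrands.
Variables a b c : 'I_n.
Hypotheses (ab : a != b) (bc : b != c) (ac : a != c).

Let ba : b != a. Proof. by rewrite eq_sym. Qed.
Let cb : c != b. Proof. by rewrite eq_sym. Qed.
Let ca : c != a. Proof. by rewrite eq_sym. Qed.
Let neqE := (eqxx, negbTE ab, negbTE ba, negbTE bc, negbTE cb, negbTE ac, negbTE ca).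
Let tpermabc : tperm a b c = c. Proof. by rewrite tpermD // eq_sym. Qed.
Let tpermbca : tperm b c a = a. Proof. by rewrite tpermD // eq_sym. Qed.
Let tpermE := (tpermL, tpermR, tpermabc, tpermbca).

Lemma three_strandsP (P : 'I_n -> Prop) :
  P a -> P b -> P c -> (forall j, j != a -> j != b -> j != c -> P j) ->
  forall j, P j.
Proof.
move=> Pa Pb Pc Pj j; have [->//|ja] := eqVneq j a.
by have [->//|jb] := eqVneq j b; have [->//|jc] := eqVneq j c; apply: Pj.
Qed.

Lemma tperm_braid :
  tperm a b * tperm b c * tperm a b = tperm b c * tperm a b * tperm b c.
Proof.
apply/permP; apply: three_strandsP => [|||j ja jb jc]; rewrite !permM ?tpermE //.
by rewrite !tpermD // eq_sym.
Qed.

(** Since automorphisms act on the right, the innermost map of each composite is the leftmost letter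
    of the braid word. *)
Lemma sigma_braid :
  sigma_end a b \o (sigma_end b c \o sigma_end a b) =1
  sigma_end b c \o (sigma_end a b \o sigma_end b c).
Proof.
apply: FZ_ext => [|z] /=; last first.
  by rewrite !FZ_end_torus !torus_permM !mulgA tperm_braid.
apply: three_strandsP => [|||j ja jb jc].
4: by rewrite !(FZ_endE, sigma_imgD).
(* One round for each of the three maps in the composite. *)
all: do 3!rewrite ?FZ_endE /sigma_img ?neqE ?tpermE /=.
- by apply: sigma_word_braid; apply: tgenC.
- by apply: sigma_wordJ; apply: tgenC.
- by [].
Qed.

(** At the two outer strands both sides are one generator conjugated twice, in different orders;
    only the middle strand involves [sigma_word]. *)
Lemma mixed_braid :
  sigma_end a b \o (rho_end b c \o rho_end a b) =1
  rho_end b c \o (rho_end a b \o sigma_end b c).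
Proof.
apply: FZ_ext => [|z] /=; last first.
  by rewrite !FZ_end_torus !torus_permM !mulgA tperm_braid.
apply: three_strandsP => [|||j ja jb jc].
4: by rewrite !(FZ_endE, sigma_imgD, rho_imgD).
all: do 3!rewrite ?FZ_endE /sigma_img /rho_img ?neqE ?tpermE /=.
- by apply: conjgAC; apply/commuteV/commute_sym/commuteV/tgenC.
- by apply: sigma_wordJ; apply: tgenC.
- by apply: conjgAC; apply: tgenC.
Qed.

(** At each of the three strands both sides are one generator conjugated by the same two torus
    elements in opposite orders. *)
Lemma rho_braid :
  rho_end a b \o (rho_end b c \o rho_end a b) =1
  rho_end b c \o (rho_end a b \o rho_end b c).
Proof.
apply: FZ_ext => [|z] /=; last first.
  by rewrite !FZ_end_torus !torus_permM !mulgA tperm_braid.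
apply: three_strandsP => [|||j ja jb jc].
4: by rewrite !(FZ_endE, rho_imgD).
all: do 3!rewrite ?FZ_endE /rho_img ?neqE ?tpermE /=.
- by apply: conjgAC; apply/commuteV/commute_sym/commuteV/tgenC.
- by apply: conjgAC; apply/commute_sym/commuteV/tgenC.
- by apply: conjgAC; apply: tgenC.
Qed.

End ThreeStrands.

(** * Commutation relations on disjoint pairs of strands *)

Section DisjointStrands.
Variables a b c d : 'I_n.
Hypotheses (ab : a != b) (cd : c != d).
Hypotheses (ac : a != c) (ad : a != d) (bc : b != c) (bd : b != d).

Let ca : c != a. Proof. by rewrite eq_sym. Qed.
Let da : d != a. Proof. by rewrite eq_sym. Qed.
Let cb : c != b. Proof. by rewrite eq_sym. Qed.
Let db : d != b. Proof. by rewrite eq_sym. Qed.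
Let ba : b != a. Proof. by rewrite eq_sym. Qed.
Let dc : d != c. Proof. by rewrite eq_sym. Qed.
Let neqE := (eqxx, negbTE ac, negbTE ca, negbTE ad, negbTE da,
  negbTE bc, negbTE cb, negbTE bd, negbTE db,
  negbTE ab, negbTE ba, negbTE cd, negbTE dc).
Let tperm_fixE := (tpermD ac bc, tpermD ad bd, tpermD ca da, tpermD cb db).

Lemma disjoint_strandsP (P : 'I_n -> Prop) :
  P a -> P b -> P c -> P d ->
  (forall j, [/\ j != a, j != b, j != c & j != d] -> P j) -> forall j, P j.
Proof.
move=> Pa Pb Pc Pd Pj j; have [->//|ja] := eqVneq j a.
have [->//|jb] := eqVneq j b; have [->//|jc] := eqVneq j c.
by have [->//|jd] := eqVneq j d; apply: Pj.
Qed.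

Lemma tperm_disjointC : commute (tperm a b) (tperm c d).
Proof.
apply/permP; apply: disjoint_strandsP => [||||j [ja jb jc jd]]; rewrite !permM.
5: by rewrite !tpermD // eq_sym.
all: by rewrite ?(tpermL, tpermR) ?tperm_fixE ?(tpermL, tpermR).
Qed.

(** Each map changes only generators of its own two strands, and their images involve only these
    strands and $v_0$, all fixed by the other map. *)
Lemma sigma_disjointC :
  sigma_end c d \o sigma_end a b =1 sigma_end a b \o sigma_end c d.
Proof.
apply: FZ_ext => [|z] /=; last first.
  by rewrite !FZ_end_torus !torus_permM tperm_disjointC.
apply: disjoint_strandsP => [||||j [ja jb jc jd]].
5: by rewrite !(FZ_endE, sigma_imgD).
all: by do 2!rewrite ?FZ_endE /sigma_img ?neqE ?tperm_fixE /=.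
Qed.

Lemma rho_disjointC :
  rho_end c d \o rho_end a b =1 rho_end a b \o rho_end c d.
Proof.
apply: FZ_ext => [|z] /=; last first.
  by rewrite !FZ_end_torus !torus_permM tperm_disjointC.
apply: disjoint_strandsP => [||||j [ja jb jc jd]].
5: by rewrite !(FZ_endE, rho_imgD).
all: by do 2!rewrite ?FZ_endE /rho_img ?neqE ?tperm_fixE /=.
Qed.

Lemma mixed_disjointC :
  rho_end c d \o sigma_end a b =1 sigma_end a b \o rho_end c d.
Proof.
apply: FZ_ext => [|z] /=; last first.
  by rewrite !FZ_end_torus !torus_permM tperm_disjointC.
apply: disjoint_strandsP => [||||j [ja jb jc jd]].
5: by rewrite !(FZ_endE, sigma_imgD, rho_imgD).
all: by do 2!rewrite ?FZ_endE /sigma_img /rho_img ?neqE ?tperm_fixE /=.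
Qed.

End DisjointStrands.

(** * The automorphisms of the generators and the defining relations *)

Definition sigma_aut a b (ab : a != b) : group_aut (FZ n) :=
  GroupAut (@gmulfM _ _ (sigma_end a b))
    (Bijective (sigma_endK ab) (sigma_inv_endK ab)).
Definition rho_aut a b (ab : a != b) : group_aut (FZ n) :=
  GroupAut (@gmulfM _ _ (rho_end a b)) (Bijective (rho_endK ab) (rho_endK ab)).

Lemma strand_neq (i : 'I_n.-1) : strand i != next_strand i.
Proof. by rewrite -val_eqE /= neq_ltn ltnSn. Qed.

Definition gen_aut (g : 'I_n.-1 + 'I_n.-1) : group_aut (FZ n) :=
  match g with
  | inl i => sigma_aut (strand_neq i)
  | inr i => rho_aut (strand_neq i)
  end.

Lemma far_strands (i j : 'I_n.-1) : far i j ->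
  [/\ strand i != strand j, strand i != next_strand j,
      next_strand i != strand j & next_strand i != next_strand j].
Proof. by rewrite /far -!val_eqE /= => ij; split; apply/negP => /eqP; lia. Qed.

Lemma adjacent_strands (i j : 'I_n.-1) : j = i.+1 :> nat ->
  next_strand i = strand j /\ strand i != next_strand j.
Proof. by move=> ij; split; [apply: val_inj | rewrite -val_eqE]; move: ij => /=; lia. Qed.

Lemma gen_aut_rel w1 w2 :
  @vb_rel n w1 w2 -> free_lift gen_aut w1 = free_lift gen_aut w2.
Proof.
(* Specialises a fact about three distinct strands to the strands of two adjacent generators; the
   returned equation identifies their common strand. *)
have adjP (P : 'I_n -> 'I_n -> 'I_n -> Prop) :
    (forall a b c, a != b -> b != c -> a != c -> P a b c) ->
    forall i j : 'I_n.-1, j = i.+1 :> nat ->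
    P (strand i) (next_strand i) (next_strand j) /\ next_strand i = strand j.
  move=> PP i j /adjacent_strands[ij neq]; split=> //.
  by apply: PP => //; [apply: strand_neq | rewrite ij strand_neq].
case=> [i j ij|i j ij|i j ij|i j ij|i j ij|i j ij|i].
all: rewrite ?expg2 ?gmulfM /= ?free_lift_gen ?mult1; apply: autP => g.
- by have [h e] := adjP _ sigma_braid _ _ ij; rewrite /= -e; apply: h.
- by have [h e] := adjP _ rho_braid _ _ ij; rewrite /= -e; apply: h.
- by have [h e] := adjP _ mixed_braid _ _ ij; rewrite /= -e; apply: h.
- by have [*] := far_strands ij; apply: sigma_disjointC; rewrite ?strand_neq.
- by have [*] := far_strands ij; apply: rho_disjointC; rewrite ?strand_neq.
- by have [*] := far_strands ij; apply: mixed_disjointC; rewrite ?strand_neq.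
- exact: rho_endK (strand_neq i) g.
Qed.

End Endomorphisms.

Theorem theorem1 (n : nat) (hn : (2 <= n)%N) :
  exists phi : {multiplicative VB n -> group_aut (FZ n)},
    forall i : 'I_n.-1, let a := strand i in let b := next_strand i in
    [/\ [/\ forall j, phi (sigma i) (x_ j) =
              if j == a then x_ a * x_ b ^ u_ a * (x_ a)^-1 ^ (v0 * u_ b)
              else if j == b then x_ a ^ v0
              else x_ j,
            forall j, phi (sigma i) (u_ j) =
              if j == a then u_ b else if j == b then u_ a else u_ j,
            phi (sigma i) v0 = v0
          & forall j, phi (sigma i) (v_ j) =
              if j == a then v_ b else if j == b then v_ a else v_ j]
      & [/\ forall j, phi (rho i) (x_ j) =
              if j == a then x_ b ^ (v_ a)^-1
              else if j == b then x_ a ^ v_ b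
              else x_ j,
            forall j, phi (rho i) (u_ j) =
              if j == a then u_ b else if j == b then u_ a else u_ j,
            phi (rho i) v0 = v0
          & forall j, phi (rho i) (v_ j) =
              if j == a then v_ b else if j == b then v_ a else v_ j]].
Proof.
(* The extension of [gen_aut] to the free group descends to [VB n]. *)
have [phi phiE] := rel_quot_lift (@gen_aut_rel n).
exists phi => i a b.
(* Turns the transposed indices of the torus generators into the case distinctions of the
   statement. *)
have tpermE (T : Type) (f : 'I_n -> T) j :
    f (tperm a b j) = if j == a then f b else if j == b then f a else f j.
  by rewrite permE /=; case: eqP => // _; case: eqP.
rewrite /sigma /rho !phiE /= !free_lift_gen /=.
split; split=> [j|j||j].
- by rewrite !x_E !u_E v0_E FZ_end_x.
- by rewrite !u_E FZ_end_t; apply: (tpermE _ (fun k => tgen (inl k))).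
- by rewrite v0_E FZ_end_t index_perm_ord0.
- rewrite !v_E FZ_end_t index_perm_lift.
  exact: (tpermE _ (fun k => tgen (inr (lift ord0 k)))).
- by rewrite !x_E !v_E FZ_end_x.
- by rewrite !u_E FZ_end_t; apply: (tpermE _ (fun k => tgen (inl k))).
- by rewrite v0_E FZ_end_t index_perm_ord0.
- rewrite !v_E FZ_end_t index_perm_lift.
  exact: (tpermE _ (fun k => tgen (inr (lift ord0 k)))).
Qed.
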